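(* Let $P$ be a finite nonempty set of points in the plane $\mathbb{R}^2$ in general position (as defined in the context). Then the $\theta_3$-graph of $P$ is connected.
   Context: Cones: for a point $p\in\mathbb{R}^2$, the three rays from $p$ making angles that are consecutive multiples of $2\pi/3$ with the negative $y$-axis partition the plane into three cones with apex $p$. They are labelled $C_0^p, C_1^p, C_2^p$ in clockwise order around $p$, where $C_0^p$ is the cone whose angular bisector is the ray from $p$ in the direction of the positive $y$-axis. Thus, measuring angles counterclockwise from the positive $x$-axis, $C_0^p$ spans directions from $30^\circ$ to $150^\circ$ (bisector $90^\circ$), $C_1^p$ spans directions from $-90^\circ$ to $30^\circ$ (bisector $-30^\circ$), and $C_2^p$ spans directions from $150^\circ$ to $270^\circ$ (bisector $210^\circ$). General position: no two distinct points of $P$ lie on a line parallel to the boundary of a cone or perpendicular to the angular bisector of a cone. Closest point: for $p\in P$ and $i\in\{0,1,2\}$, the closest point to $p$ in $C_i^p$ is the point of $P\setminus\{p\}$ in $C_i^p$ (if any exists) whose orthogonal projection onto the bisector of $C_i^p$ has the smallest Euclidean distance to $p$; by general position it is unique. $\theta_3$-graph: the undirected graph with vertex set $P$ in which, for each $p\in P$ and each $i\in\{0,1,2\}$ such that $C_i^p$ contains a point of $P\setminus\{p\}$, there is an edge between $p$ and the closest point to $p$ in $C_i^p$. *)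

(* Defs.v *)
From HB Require Import structures.
From mathcomp Require Import all_boot all_order all_algebra finmap.
From mathcomp Require Import boolp reals topology normedtype trigo.

Set Implicit Arguments.
Unset Strict Implicit.
Unset Printing Implicit Defensive.

Import Order.TTheory GRing.Theory Num.Theory.

Local Open Scope fset_scope.
Local Open Scope ring_scope.

Section ThetaThree.
Variable R : realType.

Notation point := ('rV[R]_2).

Definition dot (u v : point) : R := \sum_(j < 2) u 0 j * v 0 j.

(* The norm that the library puts on 'rV[R]_2 is the maximum norm, hence an
   explicit Euclidean distance. *)
Definition edist (p q : point) : R := Num.sqrt (dot (q - p) (q - p)).

Definition dir (t : R) : point :=
  \row_(j < 2) (if j == 0 then cos t else sin t).

(* Angles are counterclockwise from the positive x-axis. Going clockwise from
   the positive y-axis, the bisectors have angles pi/2, -pi/6 and -5pi/6. *)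
Definition bisector_angle (i : 'I_3) : R := pi / 2 - i%:R * (2 * pi / 3).

(* The bounding rays of the three cones have angles -pi/2, pi/6 and 5pi/6
   modulo 2pi. *)
Definition left_angle (i : 'I_3) : R := bisector_angle i + pi / 3.
Definition right_angle (i : 'I_3) : R := bisector_angle i - pi / 3.

(* Cones are closed, so that neighbouring ones share a bounding ray. In general
   position no point of P other than p lies on a bounding ray of a cone of p, so
   the choice of the cone owning that ray is immaterial. *)
Definition in_cone (p : point) (i : 'I_3) (q : point) : Prop :=
  exists r t : R, [/\ 0 <= r, right_angle i <= t <= left_angle i
                    & q = p + r *: dir t].

(* Projection onto the line supporting the bisector of cone i of p; if q lies in
   that cone, its projection lies on the bisector itself. *)
Definition bisector_proj (p : point) (i : 'I_3) (q : point) : point :=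
  p + dot (q - p) (dir (bisector_angle i)) *: dir (bisector_angle i).

Definition on_common_line (v p q : point) : Prop := exists c : R, q = p + c *: v.

Definition general_position (P : {fset point}) : Prop :=
  forall p q : point, p \in P -> q \in P -> p != q -> forall i : 'I_3,
    [/\ ~ on_common_line (dir (left_angle i)) p q,
        ~ on_common_line (dir (right_angle i)) p q
      & dot (q - p) (dir (bisector_angle i)) != 0].

Definition closest (P : {fset point}) (p : point) (i : 'I_3) (q : point) : Prop :=
  [/\ q \in P `\ p, in_cone p i q
    & forall q' : point, q' \in P `\ p -> in_cone p i q' ->
        edist p (bisector_proj p i q) <= edist p (bisector_proj p i q')].

Definition theta3 (P : {fset point}) : rel P :=
  fun x y => `[< exists i : 'I_3,
    closest P (val x) i (val y) \/ closest P (val y) i (val x) >].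

End ThetaThree.

Definition connected_graph (V : finType) (e : rel V) : Prop :=
  forall x y : V, connect e x y.

(* Main.v *)
Require Import Defs.
From HB Require Import structures.
From mathcomp Require Import all_boot all_order all_algebra finmap.
From mathcomp Require Import lra ring.
From mathcomp Require Import boolp reals topology normedtype trigo.

Set Implicit Arguments.
Unset Strict Implicit.
Unset Printing Implicit Defensive.

Import Order.TTheory GRing.Theory Num.Theory.

Local Open Scope fset_scope.
Local Open Scope ring_scope.

                                                                                 
                                                                                
                                                                                   
                                                                                   
                                                                                     
                                                                                     
              
                                                                                
                                                                               
                          
                                                                                 
                                                                              
                                                                                    
                                                                                  
                                                                                 
                                                                                                         
                                                              

(** Let the i-th height of a point be its scalar product with the bisector direction of cone i. The
    three heights add up to zero, and in general position [y] lies in cone i of [x] exactly when the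
    i-th height increases most from [x] to [y]. Moving repeatedly to the closest point in cone i
    yields an i-path, which ends at an i-sink, a point whose cone i is empty. Two i-paths never
    cross: their order across the bisector is kept up to their sinks ([sink_le]).

    Colour the vertices by connectivity to a fixed one; paths keep the colour. If both colours
    occurred, there would be a chain: i-sinks ordered across the bisector, neighbours of different
    colours. Following the j-paths (or k-paths) from an i-chain yields a j-chain (or k-chain) in
    reversed order ([sink_swap], [chain_step]). Reaching j-sinks directly, and by way of k-sinks,
    gives two j-chains, the first lying weakly before the second ([sinks_separated]). Once a point
    is dropped at the junction to keep the colours alternating, they join into one chain
    ([chain_grow]). So n points give 2n - 1, and from n = 2 on chains grow without bound, which a
    finite set forbids ([same_color]). *)

Lemma climbing_ind (R : realDomainType) (U : finType) (f : U -> R)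
    (Q : U -> Prop) :
  (forall u, (forall v, f u < f v -> Q v) -> Q u) -> forall u, Q u.
Proof.
move=> step u.
(* The number of elements with a larger value of [f] drops at each climb. *)
have [n] := ubnP #|[set v | f u < f v]|.
elim: n u => // n IHn u le_n; apply: step => v lt_uv; apply: IHn.
rewrite -ltnS; apply: leq_trans le_n; rewrite ltnS; apply: proper_card.
apply/properP; split; last by exists v; rewrite inE ?ltxx.
by apply/subsetP=> w; rewrite !inE; apply: lt_trans.
Qed.

Lemma ord3_cover (i j k : 'I_3) : uniq [:: i; j; k] -> forall l, l \in [:: i; j; k].
Proof.
move=> u l; have [|_ ->] := uniq_min_size u (fun l _ => mem_enum 'I_3 l).
  by rewrite size_enum_ord.
by rewrite mem_enum.
Qed.

Lemma ord3_ext (i : 'I_3) : exists j k, uniq [:: i; j; k].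
Proof.
have oP n : (n < 3)%N -> {m : 'I_3 | val m = n} by move=> lt_n; exists (Ordinal lt_n).
have [[o0 e0] [o1 e1]] := (oP 0 isT, oP 1 isT)%N; have [o2 e2] := oP 2 isT.
case: i => [[|[|[|n]]] lt_i] //; [exists o1, o2 | exists o0, o2 | exists o0, o1];
  by rewrite /= !inE -!val_eqE /= ?e0 ?e1 ?e2.
Qed.

Lemma uniq3_rot (i j k : 'I_3) : uniq [:: i; j; k] -> uniq [:: j; k; i].
Proof. by rewrite -(rot_uniq 1). Qed.

Lemma uniq3_swap (i j k : 'I_3) : uniq [:: i; j; k] -> uniq [:: i; k; j].
Proof. by rewrite /= !inE !negb_or (eq_sym k j) => /and3P[/andP[-> ->] ->]. Qed.

Lemma uniq3_neq (i j k : 'I_3) : uniq [:: i; j; k] -> [/\ i != j, j != k & k != i].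
Proof. by rewrite /= !inE negb_or andbT (eq_sym k) => /andP[/andP[-> ->] ->]. Qed.

                            

(** * Cones, paths and sinks from three heights with zero sum *)

Section Paths.
Variables (R : realFieldType) (T : finType) (h : 'I_3 -> T -> R).
Hypothesis sum_h : forall x, \sum_i h i x = 0.
Hypothesis h_inj : forall i, injective (h i).
Hypothesis h_sub_inj : forall i j : 'I_3, i != j -> injective (fun x => h i x - h j x).

Implicit Types (i j k : 'I_3) (x y z : T).

Lemma sum3 i j k x : uniq [:: i; j; k] -> h i x + h j x + h k x = 0.
Proof.
move=> u; have := sum_h x.
under eq_bigl => l do rewrite -(ord3_cover u l).
by rewrite -big_uniq // !big_cons big_nil /= addr0 addrA.
Qed.

(** The open cone; it differs from the closed one only on the boundary rays, where general position
    leaves no other vertex. *)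
Definition cone i x y :=
  [forall j, (j != i) ==> (h j y - h j x < h i y - h i x)].

Lemma coneE i j k x y : uniq [:: i; j; k] ->
  cone i x y = (h j y - h j x < h i y - h i x) && (h k y - h k x < h i y - h i x).
Proof.
move=> u; apply/forallP/andP => [C|[Cj Ck] l].
  move: u; rewrite /= !inE negb_or => /andP[/andP[ij ik] _].
  by split; apply: (implyP (C _)); rewrite eq_sym.
by apply/implyP; have := ord3_cover u l; rewrite !inE => /or3P[] /eqP->;
  rewrite ?eqxx.
Qed.

(** The three increments add up to zero, so a strictly largest one is positive. *)
Lemma cone_lt i x y : cone i x y -> h i x < h i y.
Proof.
have [j [k u]] := ord3_ext i; rewrite (coneE _ _ u) => /andP[].
by move: (sum3 x u) (sum3 y u); lra.
Qed.

Lemma cone_trans i : transitive (cone i).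
Proof.
have [j [k u]] := ord3_ext i => y x z.
by rewrite !(coneE _ _ u) => /andP[? ?] /andP[? ?]; apply/andP; split; lra.
Qed.

(** By [h_sub_inj] the three increments are pairwise distinct, so one is strictly largest. *)
Lemma cone_cover i j k x y : uniq [:: i; j; k] -> x != y ->
  [|| cone i x y, cone j x y | cone k x y].
Proof.
move=> u xy; have uj := uniq3_rot u; have uk := uniq3_rot uj.
rewrite (coneE _ _ u) (coneE _ _ uj) (coneE _ _ uk).
have lt_total a b : a != b ->
  (h a y - h a x < h b y - h b x) || (h b y - h b x < h a y - h a x).
  move=> ab; have : h a x - h b x != h a y - h b y.
    by apply: contra xy => /eqP/(h_sub_inj ab)/eqP.
  by rewrite neq_lt => /orP[] lt; apply/orP; [right|left]; lra.
move: u; rewrite /= !inE negb_or andbT => /andP[/andP[ij ik] jk].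
move/orP: (lt_total _ _ ij); move/orP: (lt_total _ _ ik).
move/orP: (lt_total _ _ jk).
move=> [] d1 [] d2 [] d3; apply/or3P;
  by [apply: Or31; apply/andP; split; lra | apply: Or32; apply/andP; split; lra
     | apply: Or33; apply/andP; split; lra].
Qed.

(** The default [x] for an empty cone makes the sinks the fixed points of [next i]. *)
Definition next i x :=
  if [pick y | cone i x y] is Some y0
  then [arg min_(y < y0 | cone i x y) h i y]%O else x.

Variant next_spec i x : T -> Prop :=
  | NextNone of (forall y, ~~ cone i x y) : next_spec i x x
  | NextSome y of cone i x y & (forall z, cone i x z -> h i y <= h i z)
      : next_spec i x y.

Lemma nextP i x : next_spec i x (next i x).
Proof.
rewrite /next; case: pickP => [y0 y0P|none].
  by case: arg_minP => // y yP ymin; apply: NextSome.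
by apply: NextNone => y; rewrite none.
Qed.

Lemma next_id i x : (next i x == x) = [forall y, ~~ cone i x y].
Proof.
case: nextP => [no|y xy _]; first by rewrite eqxx; apply/esym/forallP.
have [eq_yx|_] := eqVneq; first by have := cone_lt xy; rewrite eq_yx ltxx.
by apply/esym/negP => /forallP/(_ y); rewrite xy.
Qed.

Definition is_sink i x := next i x == x.

Lemma is_sinkP i x : reflect (forall y, ~~ cone i x y) (is_sink i x).
Proof. by rewrite /is_sink next_id; apply: forallP. Qed.

Lemma next_ind i (Q : T -> Prop) :
  (forall x, (~~ is_sink i x -> Q (next i x)) -> Q x) -> forall x, Q x.
Proof.
move=> step; apply: (@climbing_ind _ _ (h i)) => x IH; apply: step => sx; apply: IH.
move: sx; rewrite /is_sink; case: nextP => [_|y xy _ _]; last exact: cone_lt.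
by rewrite eqxx.
Qed.

(** Each proper step raises [h i], so [#|T|] steps reach a fixed point. *)
Definition sink i x := iter #|T| (next i) x.

Lemma sink_id i x : is_sink i x -> sink i x = x.
Proof. by move/eqP=> sx; rewrite /sink iter_fix. Qed.

Lemma sink_next i x : sink i (next i x) = sink i x /\ is_sink i (sink i x).
Proof.
suff iter_next n : (#|[set y | (h i x < h i y)%R]| <= n)%N ->
    is_sink i (iter n (next i) x).
  have s : is_sink i (sink i x) by apply: iter_next; apply: max_card.
  by split=> //; rewrite /sink -iterSr iterS; apply/eqP.
elim: n x => [|n IHn] x le_n.
  apply/is_sinkP => y; apply: contraTN le_n => xy; rewrite -ltnNge.
  by apply/card_gt0P; exists y; rewrite inE (cone_lt xy).
have [sx|nsx] := boolP (is_sink i x); first by rewrite iter_fix //; apply/eqP.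
rewrite iterSr; apply: IHn; rewrite -ltnS; apply: leq_trans le_n.
have lt_next : h i x < h i (next i x).
  by move: nsx; rewrite /is_sink; case: nextP => [|y /cone_lt]; rewrite ?eqxx.
apply: proper_card; apply/properP; split; last first.
  by exists (next i x); rewrite inE ?ltxx.
by apply/subsetP => y; rewrite !inE; apply: lt_trans.
Qed.

Lemma sinkP i x : is_sink i (sink i x).
Proof. by case: (sink_next i x). Qed.

Lemma next_invariant i (V : Type) (col : T -> V) :
  (forall x, col (next i x) = col x) -> forall x, col (sink i x) = col x.
Proof.
by move=> col_next x; rewrite /sink; elim: #|T| => //= n <-; rewrite col_next.
Qed.

(** * Paths of the same kind do not cross *)

(** If [x1] differs from [y], it is in cone j or cone k of [y]. Cone j is impossible, as [x1] would
    then be in cone j of [x] too; cone k gives the inequality. *)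
Lemma cone_step i j k x y x1 : uniq [:: i; j; k] ->
    cone j x y -> cone k y x -> cone i x x1 -> ~~ cone i y x1 ->
  h j x1 - h k x1 <= h j y - h k y.
Proof.
move=> u; have uj := uniq3_rot u; have uk := uniq3_rot uj.
have [->//|neq_y_x1] := eqVneq y x1; have := cone_cover u neq_y_x1.
rewrite (coneE x y uj) (coneE y x uk) (coneE x x1 u) => + /andP[? ?] /andP[? ?].
move=> + /andP[? ?] Nyx1; rewrite (negPf Nyx1) (coneE y x1 uj) (coneE y x1 uk).
by move=> /= /orP[] /andP[? ?]; lra.
Qed.

                                                                            
                                                                       
(** Advance whichever path has the lower next vertex. If the other point does not see that vertex in
    its cone i, [cone_step] keeps the order; if it does, both next vertices coincide and the paths
    merge. *)
Lemma sink_le i j k x y : uniq [:: i; j; k] -> ~~ cone i x y -> ~~ cone i y x ->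
    h j x - h k x <= h j y - h k y ->
  h j (sink i x) - h k (sink i x) <= h j (sink i y) - h k (sink i y).
Proof.
move=> u; have uj := uniq3_rot u; have uk := uniq3_rot uj.
pose Q (p : T * T) := ~~ cone i p.1 p.2 -> ~~ cone i p.2 p.1 ->
  h j p.1 - h k p.1 <= h j p.2 - h k p.2 ->
  h j (sink i p.1) - h k (sink i p.1) <= h j (sink i p.2) - h k (sink i p.2).
suff: Q (x, y) by [].
apply: (@climbing_ind _ _ (fun p => h i p.1 + h i p.2)) => {x y} -[x y] IH.
rewrite /Q /= => Nxy Nyx le_g.
have [->//|neq_xy] := eqVneq x y.
have [Cxy Cyx] : cone j x y /\ cone k y x.
  have := cone_cover u neq_xy; have := cone_cover u; rewrite eq_sym in neq_xy.
  move=> /(_ _ _ neq_xy); rewrite (negPf Nxy) (negPf Nyx) /=.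
  rewrite !(coneE _ _ uj) !(coneE _ _ uk).
  by move=> /orP[] /andP[? ?] /orP[] /andP[? ?]; split; apply/andP; split; lra.
have stepx x1 : cone i x x1 -> ~~ cone i y x1 -> sink i x1 = sink i x ->
    h j (sink i x) - h k (sink i x) <= h j (sink i y) - h k (sink i y).
  move=> xx1 Nyx1 <-; apply: (IH (x1, y)) => //=; first by rewrite ltrD2r cone_lt.
    by apply: contra Nxy; apply: cone_trans.
  exact: cone_step xx1 Nyx1.
have stepy y1 : cone i y y1 -> ~~ cone i x y1 -> sink i y1 = sink i y ->
    h j (sink i x) - h k (sink i x) <= h j (sink i y) - h k (sink i y).
  move=> yy1 Nxy1 <-; apply: (IH (x, y1)) => //=; first by rewrite ltrD2l cone_lt.
    by apply: contra Nyx; apply: cone_trans.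
  by have := cone_step (uniq3_swap u) Cyx Cxy yy1 Nxy1; lra.
move: (sink_next i x).1 (sink_next i y).1.
case: (nextP i x) => [Nx|x1 xx1 min_x]; case: (nextP i y) => [Ny|y1 yy1 min_y] ex ey.
- by rewrite !sink_id //; apply/is_sinkP.
- exact: stepy yy1 _ _.
- exact: stepx xx1 _ _.
have [le_xy|lt_yx] := leP (h i x1) (h i y1); last first.
  by apply: stepy yy1 _ ey; apply/negP => /min_x; rewrite leNgt lt_yx.
have [yx1|] := boolP (cone i y x1); last by move=> Nyx1; apply: stepx xx1 Nyx1 ex.
suff eq_xy1 : x1 = y1 by rewrite -ex -ey eq_xy1.
by apply: (@h_inj i); apply: le_anti; rewrite le_xy min_y.
Qed.

(** The witness is the last vertex of the i-path of [x] at height at most [t]; its successor, the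
    lowest point of its cone, is above [t]. *)
Lemma path_at i x t : h i x <= t ->
  exists y, [/\ sink i y = sink i x, h i y <= t & forall z, cone i y z -> t < h i z].
Proof.
elim/(@next_ind i): x => x; move: (sink_next i x).1; rewrite /is_sink.
case: nextP => [Nx _ _ le_xt|y xy min_y eq_sink IH le_xt].
  by exists x; split=> // z; rewrite (negPf (Nx z)).
have [le_yt|lt_ty] := leP (h i y) t.
  have [|//|z [ez le_zt zP]] := IH _ _; last by exists z; rewrite ez.
  by apply: contraTneq (cone_lt xy) => ->; rewrite ltxx.
by exists x; split=> // z /min_y; apply: lt_le_trans.
Qed.

(** Cut the j-path of [s] at the level of [t], at a vertex [y]. Neither of [t], [y] sees the other
    in cone j, and cone i of [t] is empty, so [y] is [t] or lies in cone k of [t]; [sink_le] carries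
    this order to the j-sinks. *)
Lemma sink_above i j k s t : uniq [:: i; j; k] -> is_sink i t -> h j s < h j t ->
  h k (sink j t) - h i (sink j t) <= h k (sink j s) - h i (sink j s).
Proof.
move=> u /is_sinkP Nt lt_st; have uj := uniq3_rot u; have uk := uniq3_rot uj.
have [y [<- le_yt Ny]] := path_at (ltW lt_st).
have Nty : ~~ cone j t y by apply: contraTN le_yt => /cone_lt; rewrite ltNge.
apply: (sink_le uj Nty); first by apply/negP => /Ny; rewrite ltxx.
have [->//|neq_ty] := eqVneq t y; have := cone_cover u neq_ty.
by rewrite (negPf (Nt y)) (negPf Nty) (coneE t y uk) /= => /andP[? ?]; lra.
Qed.

(** Both cones i being empty, [t] is in cone j of [s] and [s] in cone k of [t]; [sink_above] applies
    either way. *)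
Lemma sink_swap i j k s t : uniq [:: i; j; k] -> is_sink i s -> is_sink i t ->
    h j s - h k s < h j t - h k t ->
  h k (sink j t) - h i (sink j t) <= h k (sink j s) - h i (sink j s) /\
  h i (sink k t) - h j (sink k t) <= h i (sink k s) - h j (sink k s).
Proof.
move=> u sink_s sink_t lt_st; have uj := uniq3_rot u; have uk := uniq3_rot uj.
have [/is_sinkP Ns /is_sinkP Nt] := (sink_s, sink_t).
have neq_st : s != t by apply: contraTneq lt_st => ->; rewrite ltxx.
have Cst : cone j s t.
  have := cone_cover u neq_st; rewrite (negPf (Ns t)) (coneE s t uk) /=.
  by case/orP=> [//|/andP[? ?]]; exfalso; lra.
have Cts : cone k t s.
  have := cone_cover u; rewrite eq_sym in neq_st; move=> /(_ _ _ neq_st).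
  rewrite (negPf (Nt s)) (coneE t s uj) /=.
  by case/orP=> [/andP[? ?]|//]; exfalso; lra.
split; first by apply: sink_above (cone_lt Cst).
by have := sink_above (uniq3_swap u) sink_s (cone_lt Cts); lra.
Qed.

(** Apply [sink_above] to whichever of [s], [t] has the larger [h j], with i and k exchanged in the
    second case. *)
Lemma sinks_separated i j k s t : uniq [:: i; j; k] ->
    is_sink i s -> is_sink k t ->
  h k (sink j s) - h i (sink j s) <= h k (sink j t) - h i (sink j t).
Proof.
move=> u sink_s sink_t; have [lt_ts|lt_st|/h_inj->//] := ltgtP (h j t) (h j s).
  exact: sink_above lt_ts.
have u' : uniq [:: k; j; i] by rewrite -rev_uniq.
by have := sink_above u' sink_t lt_st; lra.
Qed.

(** * Alternating chains of sinks *)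

Variable col : T -> bool.
Hypothesis col_next : forall i x, col (next i x) = col x.

Lemma col_sink i x : col (sink i x) = col x.
Proof. by apply: next_invariant => {}x; apply: col_next. Qed.

Definition alternates j k x y :=
  (h j x - h k x < h j y - h k y) && (col x != col y).

                                                                              
                                                                             
                                                 
(** Up to scale, [h j - h k] is the coordinate perpendicular to the bisector of cone i. *)
Definition chain i j k (s : seq T) :=
  all (is_sink i) s && sorted (alternates j k) s.

Lemma alternatesI j k x y : j != k -> h j x - h k x <= h j y - h k y ->
  col x != col y -> alternates j k x y.
Proof.
move=> jk le_xy neq_col; rewrite /alternates neq_col lt_neqAle le_xy !andbT.
by apply: contra neq_col => /eqP/(h_sub_inj jk)->.
Qed.

Lemma chain_step i j k s : uniq [:: i; j; k] -> chain i j k s ->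
  chain j k i (rev (map (sink j) s)) /\ chain k i j (rev (map (sink k) s)).
Proof.
move=> u /andP[sinks alt]; have [ij jk ki] := uniq3_neq u.
by split; (apply/andP; split;
  first by rewrite all_rev all_map; apply/allP => x _; apply: sinkP);
  rewrite rev_sorted; apply: homo_sorted_in sinks alt => x y sx sy /andP[lt_xy nc];
  have [le_j le_k] := sink_swap u sx sy lt_xy;
  apply: alternatesI; rewrite // !col_sink eq_sym.
Qed.

(** The first half ends at [sink j x]. The detour through k-sinks reverses twice, so its chain would
    start at [sink j (sink k x)], of the same colour; this point is left out, and the two halves
    meet by [sinks_separated]. *)
Lemma chain_grow i j k x s : uniq [:: i; j; k] -> chain i j k (x :: s) ->
  chain j k i (rev (map (sink j) (x :: s)) ++ map (sink j \o sink k) s).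
Proof.
move=> u ch; have uj := uniq3_rot u; have uk := uniq3_rot uj.
have [ch1 ch2] := chain_step u ch; move: (chain_step uk ch2).2 ch1.
rewrite map_rev revK -map_comp /= rev_cons.
case/andP=> /= /andP[sinks2 sinks2'] alt2 /andP[sinks1 alt1].
apply/andP; split; first by rewrite all_cat sinks1.
rewrite cat_rcons sorted_cat_cons alt1 /=.
clear alt1 sinks1 ch2; case: s ch sinks2' alt2 => //= y s ch _ alt2.
case/andP: alt2 => _ ->; rewrite andbT.
case/andP: ch => /= /and3P[sx sy _] /andP[/andP[_ neq_col] _].
apply: alternatesI; first by case/uniq3_neq: uj.
  by apply: sinks_separated u sx _; apply: sinkP.
by rewrite !col_sink.
Qed.

Lemma same_color x y : col x = col y.
Proof.
apply/eqP/negPn/negP => neq_col.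
have long_chain n : exists i j k s,
    [/\ uniq [:: i; j; k], chain i j k s & (n.+1 < size s)%N].
  elim: n => [|n [i [j [k [s [u ch lt_n]]]]]].
    have [j [k u]] := ord3_ext ord0.
    have [le_xy|lt_yx] := leP (h j (sink ord0 x) - h k (sink ord0 x))
                              (h j (sink ord0 y) - h k (sink ord0 y)).
      exists ord0, j, k, [:: sink ord0 x; sink ord0 y]; split=> //.
      rewrite /chain /= !sinkP !andbT /=; apply: alternatesI => //.
        by case/uniq3_neq: u.
      by rewrite !col_sink.
    exists ord0, j, k, [:: sink ord0 y; sink ord0 x]; split=> //.
    by rewrite /chain /= !sinkP /alternates lt_yx !col_sink eq_sym neq_col.
  case: s ch lt_n => // z s ch lt_n.
  exists j, k, i, (rev (map (sink j) (z :: s)) ++ map (sink j \o sink k) s).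
  split; [exact: uniq3_rot | exact: chain_grow |].
  rewrite size_cat size_rev !size_map /= addSn ltnS; move: lt_n => /=.
  by case: (size s) => // m; rewrite addnS ltnS => lt_n; apply: leq_trans (leq_addr _ _).
have [i [j [k [s [_ /andP[_ alt] lt_s]]]]] := long_chain #|T|.
(* The order in a chain is strict, so its points are distinct. *)
have uniq_s : uniq s.
  apply: (@sorted_uniq _ (fun x y => h j x - h k x < h j y - h k y)).
  - by move=> ? ? ?; apply: lt_trans.
  - by move=> ?; rewrite ltxx.
  - by apply: sub_sorted alt => ? ? /andP[].
have := max_card (mem s); rewrite (card_uniqP uniq_s) leqNgt.
by rewrite (leq_trans _ lt_s).
Qed.

End Paths.

                                     

(** * Trigonometry of the three cones *)

Section Cones.
Variable R : realType.
Notation point := ('rV[R]_2).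
Implicit Types (u v p q : point) (a t : R) (i j k : 'I_3).

Lemma dotE u v : dot u v = u 0 0 * v 0 0 + u 0 1 * v 0 1.
Proof.
rewrite /dot !big_ord_recl big_ord0 addr0.
by rewrite (_ : lift ord0 ord0 = 1) //; apply: val_inj.
Qed.

Lemma dot_dir v t : dot v (dir t) = v 0 0 * cos t + v 0 1 * sin t.
Proof. by rewrite dotE !mxE. Qed.

Lemma point_eqP u v : u 0 0 = v 0 0 -> u 0 1 = v 0 1 -> u = v.
Proof.
move=> eq0 eq1; apply/rowP => -[[|[|//]] lt_m].
  by rewrite (_ : Ordinal _ = 0) //; apply: val_inj.
by rewrite (_ : Ordinal _ = 1) //; apply: val_inj.
Qed.

(** As [pi - pi / 3] is twice [pi / 3], the cosine c satisfies -c = 2c^2 - 1, whose only positive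
    root is 1/2. *)
Lemma cos_pi3 : cos (pi / 3) = 2^-1 :> R.
Proof.
have : cos (pi - pi / 3) = cos ((pi / 3) *+ 2) :> R by congr cos; field.
rewrite cosB cospi sinpi cos_mulr2n mul0r addr0 mulN1r.
have : 0 < cos (pi / 3 : R) by apply: cos_gt0_pihalf; have := pi_gt0 R; lra.
set c := cos _ => c_gt0 eq_c.
have /eqP : (c - 2^-1) * (c + 1) = 0 by lra.
by rewrite mulf_eq0 => /orP[] /eqP; lra.
Qed.

Lemma sin_pi3_gt0 : 0 < sin (pi / 3 : R).
Proof. by apply: sin_gt0_pi; have := pi_gt0 R; lra. Qed.

Lemma sin_pi3_sqr : sin (pi / 3 : R) ^+ 2 = 3 / 4.
Proof. by rewrite sin2cos2 cos_pi3; field. Qed.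

Definition height i v := dot v (dir (bisector_angle R i)).
Definition offset i v := dot v (dir (bisector_angle R i + pi / 2)).

Lemma frame i v :
  v = height i v *: dir (bisector_angle R i)
      + offset i v *: dir (bisector_angle R i + pi / 2).
Proof.
rewrite /height /offset !dot_dir; set b := bisector_angle R i.
have E x : x = x * (cos b ^+ 2 + sin b ^+ 2) by rewrite cos2Dsin2 mulr1.
by apply: point_eqP; rewrite !mxE /= !cosDpihalf !sinDpihalf [LHS]E; ring.
Qed.

Lemma cos_2pi3 : cos (2 * pi / 3) = - 2^-1 :> R.
Proof.
by rewrite (_ : 2 * pi / 3 = pi - pi / 3); [rewrite cosB cospi sinpi cos_pi3|]; field.
Qed.

Lemma sin_2pi3 : sin (2 * pi / 3) = sin (pi / 3) :> R.
Proof.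
by rewrite (_ : 2 * pi / 3 = pi - pi / 3); [rewrite sinB cospi sinpi|field]; ring.
Qed.

(** Here [j] is the clockwise and [k] the counterclockwise neighbour of [i]; the ray separating
    their cones is opposite to bisector i. *)
Lemma bisector_angle_next i : exists j k, [/\ uniq [:: i; j; k],
    dir (bisector_angle R j) = dir (bisector_angle R i - 2 * pi / 3),
    dir (bisector_angle R k) = dir (bisector_angle R i + 2 * pi / 3)
  & dir (right_angle R j) = - dir (bisector_angle R i)].
Proof.
have dir2pi t : dir (t + pi *+ 2) = dir t :> point.
  by apply: point_eqP; rewrite !mxE /= ?cosD2pi ?sinD2pi.
have dirpi t : dir (t + pi) = - dir t :> point.
  by apply: point_eqP; rewrite !mxE /= ?cosDpi ?sinDpi.
have oP n : (n < 3)%N -> {m : 'I_3 | val m = n}.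
  by move=> lt_n; exists (Ordinal lt_n).
have [[o0 e0] [o1 e1]] := (oP 0 isT, oP 1 isT)%N; have [o2 e2] := oP 2 isT.
rewrite /right_angle /bisector_angle.
case: i => [[|[|[|n]]] lt_i] //; [exists o1, o2 | exists o2, o0 | exists o0, o1];
  (split; first by rewrite /= !inE -!val_eqE /= ?e0 ?e1 ?e2); rewrite /= ?e0 ?e1 ?e2.
- by congr dir; ring.
- by rewrite -[LHS]dir2pi; congr dir; field.
- by rewrite -[in RHS]dirpi -[LHS]dir2pi; congr dir; field.
- by congr dir; field.
- by congr dir; field.
- by rewrite -[in RHS]dirpi -[LHS]dir2pi; congr dir; field.
- by rewrite -[RHS]dir2pi; congr dir; field.
- by congr dir; field.
- by rewrite -[in RHS]dirpi; congr dir; field.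
Qed.

Lemma dotBl u v p : dot (u - v) p = dot u p - dot v p.
Proof. by rewrite !dotE !mxE; ring. Qed.

Lemma height_frame i : exists j k, [/\ uniq [:: i; j; k],
    forall v, height j v = - (height i v / 2) - sin (pi / 3) * offset i v,
    forall v, height k v = - (height i v / 2) + sin (pi / 3) * offset i v
  & dir (right_angle R j) = - dir (bisector_angle R i)].
Proof.
have [j [k [u ej ek er]]] := bisector_angle_next i; exists j, k.
split=> // v; rewrite /height /offset ?ej ?ek !dot_dir cosDpihalf sinDpihalf.
  by rewrite cosB sinB cos_2pi3 sin_2pi3; field.
by rewrite cosD sinD cos_2pi3 sin_2pi3; field.
Qed.

(** The hypothesis says |B| <= tan(pi/3) A, the wedge of half-angle pi/3. For B >= 0 the angle is
    the arc cosine of A / r. *)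
Lemma polar (A B : R) : sin (pi / 3) * `|B| <= 3 / 2 * A ->
  exists r w : R, [/\ 0 <= r, - (pi / 3) <= w <= pi / 3, A = r * cos w & B = r * sin w].
Proof.
wlog B_ge0 : B / 0 <= B => [th leBA|].
  have [B_ge0|/ltW B_le0] := leP 0 B; first exact: th.
  have [||r [w [r_ge0 w_le eA eB]]] := th (- B); rewrite ?oppr_ge0 ?normrN //.
  exists r, (- w); split=> //; [lra | by rewrite cosN |].
  by rewrite sinN mulrN -eB opprK.
rewrite ger0_norm // => leBA; have s_gt0 := sin_pi3_gt0; have s_sqr := sin_pi3_sqr.
have pi_gt := pi_gt0 R.
have A_ge0 : 0 <= A by nra.
set r := Num.sqrt (A ^+ 2 + B ^+ 2).
have r_ge0 : 0 <= r by apply: sqrtr_ge0.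
have r_sqr : r ^+ 2 = A ^+ 2 + B ^+ 2 by rewrite sqr_sqrtr //; nra.
have [r0|r_neq0] := eqVneq r 0.
  by exists 0, 0; rewrite !mul0r; split; nra.
have r_gt0 : 0 < r by rewrite lt_def r_neq0.
have le_Ar : A <= r by nra.
(* Squaring the hypothesis gives B^2 <= 3 A^2, hence r^2 <= 4 A^2. *)
have le_rA : r <= 2 * A.
  have : (sin (pi / 3) * B) ^+ 2 <= (3 / 2 * A) ^+ 2 by rewrite ler_sqr ?nnegrE; nra.
  by rewrite exprMn s_sqr => ?; nra.
pose y := A / r.
have y_ge : 2^-1 <= y by rewrite ler_pdivlMr //; lra.
have y_le : y <= 1 by rewrite ler_pdivrMr // mul1r.
have y_in : -1 <= y <= 1 by apply/andP; split=> //; lra.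
have ey : cos (acos y) = y by rewrite acosK // in_itv.
have eA : A = r * cos (acos y) by rewrite ey mulrC divfK.
exists r, (acos y); split=> //.
  rewrite (le_trans _ (acos_ge0 y_in)) /=; last lra.
  rewrite leNgt -ltr_cos ?in_itv /= ?acos_ge0 ?acos_lepi //; last lra.
  by rewrite ey cos_pi3 -leNgt.
rewrite sin_acos //; apply/eqP; rewrite -(@eqrXn2 _ 2) ?mulr_ge0 ?sqrtr_ge0 //.
rewrite exprMn (@sqr_sqrtr _ (1 - y ^+ 2)); last by nra.
by rewrite mulrBr mulr1 -exprMn [r * y]mulrC divfK // r_sqr; apply/eqP; ring.
Qed.

(** In the frame of bisector i both sides amount to the wedge inequality of [polar]. *)
Lemma in_coneP p i q :
  in_cone p i q <-> forall j, height j (q - p) <= height i (q - p).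
Proof.
have s_gt0 := sin_pi3_gt0; have s_sqr := sin_pi3_sqr.
have [j [k [u ej ek _]]] := height_frame i.
have -> : (forall l, height l (q - p) <= height i (q - p)) <->
    sin (pi / 3) * `|offset i (q - p)| <= 3 / 2 * height i (q - p).
  rewrite -[X in X * `|_|](ger0_norm (ltW s_gt0)) -normrM ler_norml.
  split=> [C|/andP[C1 C2] l].
    by apply/andP; split; [have := C j | have := C k]; rewrite ?ej ?ek; lra.
  have := ord3_cover u l; rewrite !inE => /or3P[] /eqP->; rewrite ?ej ?ek //; lra.
split=> [[r [t [r_ge0 le_t ->]]]|/polar[r [w [r_ge0 w_le eA eB]]]]; last first.
  exists r, (bisector_angle R i + w); split=> //.
    by move: w_le; rewrite /right_angle /left_angle !lerD2l.
  rewrite -[LHS](subrK p) addrC; congr (_ + _); rewrite [LHS](frame i) eA eB.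
  move: (bisector_angle R i) => b.
  by apply: point_eqP; rewrite !mxE /= ?cosDpihalf ?sinDpihalf ?cosD ?sinD; ring.
rewrite addrAC subrr add0r; set b := bisector_angle R i; set w := t - b.
have -> : height i (r *: dir t) = r * cos w.
  by rewrite /height dot_dir !mxE /= -/b (cosB t b); ring.
have -> : offset i (r *: dir t) = r * sin w.
  by rewrite /offset dot_dir !mxE /= -/b cosDpihalf sinDpihalf (sinB t b); ring.
have w_le : `|w| <= pi / 3.
  by move: le_t; rewrite /right_angle /left_angle -/b ler_norml /w; lra.
have cos_ge : 2^-1 <= cos w.
  rewrite -cos_pi3 -[cos w]cos_norm leNgt ltr_cos -?leNgt // in_itv /=;
    have := pi_gt0 R; have := normr_ge0 w; lra.
rewrite normrM (ger0_norm r_ge0) mulrCA [leRHS]mulrCA ler_wpM2l //.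
have sin_sqr : sin w ^+ 2 <= 3 / 4 by rewrite sin2cos2; nra.
by case: (ger0P (sin w)) => _; nra.
Qed.

Lemma edist_bisector_proj p i q :
  Defs.edist p (bisector_proj p i q) = `|height i (q - p)|.
Proof.
rewrite /Defs.edist /bisector_proj -/(height i (q - p)) addrAC subrr add0r -sqrtr_sqr.
congr Num.sqrt; rewrite dotE !mxE /=; set b := bisector_angle R i.
by rewrite -[RHS]mulr1 -(cos2Dsin2 b); ring.
Qed.

Lemma sum_height v : \sum_i height i v = 0.
Proof.
have [j [k [u ej ek _]]] := height_frame ord0.
under eq_bigl => l do rewrite -(ord3_cover u l).
by rewrite -big_uniq // !big_cons big_nil ej ek /=; field.
Qed.

End Cones.

(** * Transfer to the graph *)

Section ThetaThreePaths.
Variables (R : realType) (P : {fset 'rV[R]_2}).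
Hypothesis gpP : general_position P.

Definition vertex_height (i : 'I_3) (x : P) : R := height i (val x).

Lemma vertex_heightB i x y :
  height i (val y - val x) = vertex_height i y - vertex_height i x.
Proof. exact: dotBl. Qed.

Lemma vertex_height_sum x : \sum_i vertex_height i x = 0.
Proof. exact: sum_height. Qed.

Lemma vertex_height_inj i : injective (vertex_height i).
Proof.
move=> x y eq_h; apply/eqP/negPn/negP => neq_xy.
have [_ _ /negP[]] := gpP (valP x) (valP y) neq_xy i.
by rewrite -/(height i _) vertex_heightB eq_h subrr.
Qed.

(** Equal increments of two heights put the difference vector on the line of the third bisector,
    which carries a boundary ray; general position excludes this. *)
Lemma vertex_height_sub_inj (i j : 'I_3) : i != j ->
  injective (fun x => vertex_height i x - vertex_height j x).
Proof.
move=> ij x y /= eq_h; apply/eqP/negPn/negP => neq_xy.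
pose v := val y - val x.
have eq_v : height i v = height j v by rewrite !vertex_heightB; lra.
have [k u] : exists k, uniq [:: k; i; j].
  have [a [b u]] := ord3_ext i; have := ord3_cover u j.
  rewrite !inE [j == i]eq_sym (negPf ij) /= => /orP[] /eqP ->; [exists b | exists a].
    exact: uniq3_rot (uniq3_rot u).
  exact: uniq3_rot (uniq3_rot (uniq3_swap u)).
have [a [b [u' ea eb er]]] := height_frame R k.
have off0 : offset k v = 0.
  apply/eqP; rewrite -(mulrI_eq0 _ (@mulfI _ _ (lt0r_neq0 (sin_pi3_gt0 R)))).
  have [ki _ jk] := uniq3_neq u.
  have := ord3_cover u' j; have := ord3_cover u' i; move: eq_v ij.
  rewrite !inE [i == k]eq_sym (negPf ki) (negPf jk) /=.
  by move=> eq_v ij /orP[] /eqP ei /orP[] /eqP ej; move: eq_v ij;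
    rewrite ei ej ?eqxx // ea eb => eq_v _; apply/eqP; lra.
have [_ not_line _] := gpP (valP x) (valP y) neq_xy a; apply: not_line.
exists (- height k v); rewrite er scaleNr scalerN opprK.
by rewrite -[LHS](subrK (val x)) addrC [X in _ + X](frame k) off0 scale0r addr0.
Qed.

Lemma connect_next i x : connect (@theta3 R P) x (next vertex_height i x).
Proof.
case: nextP => [_|y xy min_y]; first exact: connect0.
apply/connect1/asboolP; exists i; left.
have lt_xy := cone_lt vertex_height_sum xy.
split.
- rewrite in_fsetD1 (valP y) andbT; apply: contraTneq lt_xy => /val_inj->.
  by rewrite ltxx.
- apply/in_coneP => j; rewrite !vertex_heightB.
  have [->//|ji] := eqVneq j i; apply: ltW.
  by move/forallP/(_ j)/implyP: xy; apply.
move=> q' /fsetD1P[neq_q'x Pq'] /in_coneP; pose z : P := [` Pq']%fset.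
have neq_zx : z != x by apply: contra neq_q'x => /eqP <-.
(* The closed cone of [closest] gives weak inequalities; [vertex_height_sub_inj] makes them
   strict. *)
rewrite -[q']/(val z) => cone_z; have /min_y le_yz : cone vertex_height i x z.
  apply/forallP => j; apply/implyP => ji; rewrite lt_neqAle -!vertex_heightB.
  rewrite cone_z andbT !vertex_heightB; apply: contra neq_zx => /eqP eq_h.
  by apply/eqP; apply: (vertex_height_sub_inj ji) => /=; lra.
rewrite !edist_bisector_proj !vertex_heightB.
have ge0 t : vertex_height i y <= vertex_height i t ->
    `|vertex_height i t - vertex_height i x| = vertex_height i t - vertex_height i x.
  by move=> le_yt; rewrite ger0_norm // subr_ge0 (le_trans (ltW lt_xy)).
by rewrite !ge0 // lerD2r.
Qed.

End ThetaThreePaths.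

Theorem theorem5 (R : realType) (P : {fset 'rV[R]_2}) (hP : P != fset0)
  (hgp : general_position P) : connected_graph (@theta3 R P).
Proof.
have theta3_sym : connect_sym (@theta3 R P).
  apply: sym_connect_sym => x y; apply/asboolP/asboolP => -[i xy]; exists i;
    by case: xy; [right|left].
(* The colour of a vertex is whether it is connected to [x]. *)
move=> x y; have col_next i z : connect (@theta3 R P) x (next (@vertex_height R P) i z)
    = connect (@theta3 R P) x z.
  by rewrite -(same_connect_r theta3_sym (connect_next hgp i z)).
rewrite -(same_color (@vertex_height_sum R P) (vertex_height_inj hgp)
  (vertex_height_sub_inj hgp) col_next x).
exact: connect0.
Qed.
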